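(* Let $\mathbb{P}=(P,\leq)$ be the random poset and let $\mathcal{O}_1,\mathcal{O}_2,\mathcal{O}_3\subseteq P^3$ be the ternary relations defined below. Then the relational structure $(P,\mathcal{O}_1,\mathcal{O}_2,\mathcal{O}_3)$ is homogeneous, i.e., every isomorphism between finite induced substructures of it extends to an automorphism of it.
   Context: For a poset, $x<y$ means $x\le y$, $x\ne y$, and $x\perp y$ means $x,y$ are incomparable. The random poset $\mathbb{P}=(P,\leq)$ is the (unique up to isomorphism) countably infinite poset such that for every finite $Q\subseteq P$ and every one-point extension $(Q\cup\{s\},\leq')$ of $(Q,\leq)$ there is $a\in P\setminus Q$ such that the map fixing $Q$ pointwise and sending $s$ to $a$ is an isomorphism onto $(Q\cup\{a\},\leq)$. Define $\mathcal{O}_2$ as the set of triples $(x,y,z)$ of pairwise distinct elements of $P$ satisfying one of: $x<y<z$; $y<z<x$; $z<x<y$; $x<y$ with $z\perp x$, $z\perp y$; $y<z$ with $x\perp y$, $x\perp z$; $z<x$ with $y\perp x$, $y\perp z$. Define $\mathcal{O}_3$ as the set of triples $(x,y,z)$ of pairwise distinct elements satisfying one of: $x>y>z$; $y>z>x$; $z>x>y$; $x>y$ with $z\perp x$, $z\perp y$; $y>z$ with $x\perp y$, $x\perp z$; $z>x$ with $y\perp x$, $y\perp z$. Define $\mathcal{O}_1$ as the set of triples of pairwise distinct elements of $P$ lying in neither $\mathcal{O}_2$ nor $\mathcal{O}_3$. *)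

(* Defs.v *)
From HB Require Import structures.
From mathcomp Require Import all_boot all_order.
From mathcomp Require Import finmap.
Set Implicit Arguments.
Unset Strict Implicit.
Unset Printing Implicit Defensive.

Import Order.TTheory.

(* A relational structure with ternary relations indexed by I. *)
Definition structure3 (I T : Type) := I -> T -> T -> T -> bool.

Definition isomorphism (I S T : Type) (R : structure3 I S)
    (R' : structure3 I T) (f : S -> T) : Prop :=
  bijective f /\ forall i x y z, R i x y z = R' i (f x) (f y) (f z).

Definition automorphism (I T : Type) (R : structure3 I T) (g : T -> T) : Prop :=
  isomorphism R R g.

Definition induced (I : Type) (T : choiceType) (R : structure3 I T)
    (A : {fset T}) : structure3 I A :=
  fun i x y z => R i (val x) (val y) (val z).
Arguments induced {I T} R A.

Definition homogeneous (I : Type) (T : choiceType) (R : structure3 I T) : Prop :=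
  forall (A B : {fset T}) (f : A -> B),
    isomorphism (induced R A) (induced R B) f ->
    exists g : T -> T, automorphism R g /\ forall x : A, g (val x) = val (f x).

Section RandomPoset.
Local Open Scope order_scope.
Variables (d : Order.disp_t) (P : porderType d).
Implicit Types x y z : P.

(* The new point s of a one-point extension of Q is None : option Q. *)
Definition one_point_extension (Q : {fset P}) (le' : rel (option Q)) : Prop :=
  [/\ reflexive le', antisymmetric le', transitive le' &
      forall x y : Q, le' (Some x) (Some y) = (val x <= val y)].

Definition extension_property : Prop :=
  forall (Q : {fset P}) (le' : rel (option Q)),
    one_point_extension le' ->
    exists2 a : P, a \notin Q &
      forall u v : option Q, le' u v = (oapp val a u <= oapp val a v).

Definition random_poset : Prop :=
  (exists e : nat -> P, bijective e) /\ extension_property.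

(* x >< y is incomparability; it fails when x = y. *)
Definition O2 x y z : bool :=
  uniq [:: x; y; z] &&
  [|| [&& x < y & y < z],
      [&& y < z & z < x],
      [&& z < x & x < y],
      [&& x < y, z >< x & z >< y],
      [&& y < z, x >< y & x >< z] |
      [&& z < x, y >< x & y >< z]].

Definition O3 x y z : bool :=
  uniq [:: x; y; z] &&
  [|| [&& x > y & y > z],
      [&& y > z & z > x],
      [&& z > x & x > y],
      [&& x > y, z >< x & z >< y],
      [&& y > z, x >< y & x >< z] |
      [&& z > x, y >< x & y >< z]].

Definition O1 x y z : bool :=
  [&& uniq [:: x; y; z], ~~ O2 x y z & ~~ O3 x y z].

Definition O_structure : structure3 'I_3 P := tnth [tuple O1; O2; O3].

End RandomPoset.

Arguments random_poset {d} P.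
Arguments O_structure {d} P.

(* Main.v *)
(** Give a poset the directed distance [d x y] = 0, 1 or 2 according to whether
    x <= y, x is incomparable to y, or x > y.  It satisfies the triangle
    inequality, [d x y + d y x = 2] for x <> y, and conversely any such distance
    comes from a partial order.  The perimeter
    [d x y + d y z + d z x] of three distinct points is 2, 3 or 4, and these
    values define O2, O1 and O3 respectively: partial isomorphisms are
    the maps that preserve perimeters.  Such a map changes [d] by an integer
    coboundary, so extending it to a new point p amounts to choosing an integer
    subject to lower and upper bounds, one of each for every point of the
    domain; the triangle inequality makes these bounds compatible.  The
    extension property realizes the resulting distances and a back-and-forth
    argument concludes. *)
Require Import Defs.
From mathcomp Require Import all_boot all_order.
From mathcomp Require Import finmap zify.
Set Implicit Arguments.
Unset Strict Implicit.
Unset Printing Implicit Defensive.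

Import Order.TTheory.

(** * Back-and-forth for an abstract family of finite partial maps *)

Section BackAndForth.
Variables (T : choiceType) (e : nat -> T) (e' : T -> nat).
Hypothesis e'K : cancel e' e.
Variable good : pred (seq (T * T)).
Hypothesis good_inj : forall L u v, good L -> u \in L -> v \in L ->
  (u.1 == v.1) = (u.2 == v.2).
Hypothesis forth : forall L p, good L -> exists q, good ((p, q) :: L).
Hypothesis back : forall L q, good L -> exists p, good ((p, q) :: L).

(** Both new values are packed into one pair, so that a single [xchoose] extracts them in
    [chain]. *)
Lemma back_and_forth_step L x : good L ->
  exists yz : T * T, good [:: (yz.2, x), (x, yz.1) & L].
Proof.
move=> /(forth x)[y /(back x)[z gL]].
by exists (y, z).
Qed.

Fixpoint chain (L0 : {L | good L}) n : {L | good L} :=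
  if n is n'.+1 then
    let L := chain L0 n' in
    exist (fun L => good L) _ (xchooseP (back_and_forth_step (e n') (svalP L)))
  else L0.

Lemma chain_le L0 m n : m <= n ->
  {subset sval (chain L0 m) <= sval (chain L0 n)}.
Proof.
elim: n => [|n IHn]; first by rewrite leqn0 => /eqP->.
rewrite leq_eqVlt => /predU1P[->//|/IHn sub] u /sub uL.
by rewrite /= !inE uL !orbT.
Qed.

Lemma chain_mem L0 n :
  (exists y, (e n, y) \in sval (chain L0 n.+1)) /\
  (exists y, (y, e n) \in sval (chain L0 n.+1)).
Proof.
pose yz := xchoose (back_and_forth_step (e n) (svalP (chain L0 n))).
by split; [exists yz.1 | exists yz.2]; rewrite /= !inE eqxx ?orbT.
Qed.

(** The limit map is described through finite sets: each of them is handled by one good list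
    extending [L0], which is all that finitary relations can see. *)
Lemma back_and_forth L0 : good L0 ->
  exists2 g : T -> T, bijective g &
    forall s : seq T, exists2 L, good L &
      {subset L0 <= L} /\ {in s, forall x, (x, g x) \in L}.
Proof.
move=> gL0; pose C n := sval (chain (exist _ L0 gL0) n).
have goodC n : good (C n) := svalP (chain _ n).
(* The point [x = e (e' x)] is treated in passing from stage [e' x] to the next one. *)
have dom x : exists y, (x, y) \in C (e' x).+1.
  have [y yC] := (chain_mem (exist _ L0 gL0) (e' x)).1.
  by exists y; rewrite e'K in yC.
have ran x : exists y, (y, x) \in C (e' x).+1.
  have [y yC] := (chain_mem (exist _ L0 gL0) (e' x)).2.
  by exists y; rewrite e'K in yC.
pose g x := xchoose (dom x); pose h x := xchoose (ran x).
have gC x : (x, g x) \in C (e' x).+1 := xchooseP (dom x).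
have hC x : (h x, x) \in C (e' x).+1 := xchooseP (ran x).
have inj m n u v : u \in C m -> v \in C n -> (u.1 == v.1) = (u.2 == v.2).
  move=> um vn; apply: (good_inj (goodC (maxn m n)));
    last exact: (chain_le (leq_maxr m n) vn).
  exact: (chain_le (leq_maxl m n) um).
exists g.
  exists h => x; apply/eqP.
    by rewrite (inj _ _ _ _ (hC (g x)) (gC x)) /=.
  by rewrite -(inj _ _ _ _ (gC (h x)) (hC x)) /=.
move=> s; exists (C (\max_(x <- s) (e' x).+1)) => //.
split=> [|x xs]; first exact: (@chain_le (exist _ L0 gL0) 0).
by apply: chain_le (gC x); apply: (bigmaxn_sup_seq x).
Qed.

End BackAndForth.

(** * Directed distances and perimeters in a poset *)

Section Distance.
Local Open Scope order_scope.
Variables (d : Order.disp_t) (P : porderType d).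
Implicit Types x y z : P.

Definition dist x y : nat := if x <= y then 0 else if y <= x then 2 else 1.

Definition perimeter x y z : nat := (dist x y + dist y z + dist z x)%N.

Lemma dist_eq0 x y : (dist x y == 0%N) = (x <= y).
Proof. by rewrite /dist; case: ifP => // _; case: ifP. Qed.

Lemma distxx x : dist x x = 0%N.
Proof. by rewrite /dist lexx. Qed.

Lemma dist_le2 x y : (dist x y <= 2)%N.
Proof. by rewrite /dist; case: ifP => // _; case: ifP. Qed.

Lemma distC x y : (dist x y + dist y x)%N = if x == y then 0%N else 2.
Proof.
rewrite /dist eq_le.
by case: (x <= y) (y <= x) => [] [].
Qed.

Lemma dist_triangle x y z : (dist x z <= dist x y + dist y z)%N.
Proof.
have := @le_trans _ _ y x z; have := @le_trans _ _ x z y.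
have := @le_trans _ _ z y x.
rewrite /dist.
case: (x <= y) (y <= x) (y <= z) (z <= y) (x <= z) (z <= x)
  => [] [] [] [] [] [] //= h1 h2 h3;
  first [by have := h1 isT isT | by have := h2 isT isT | by have := h3 isT isT].
Qed.

Lemma perimeter_rot x y z : perimeter x y z = perimeter y z x.
Proof. rewrite /perimeter; lia. Qed.

Lemma perimeterxx x y : perimeter x x y = if x == y then 0%N else 2.
Proof. by rewrite /perimeter distxx distC. Qed.

Lemma perimeter_degenerate x y z : ~~ uniq [:: x; y; z] ->
  perimeter x y z = if (x == y) && (y == z) then 0%N else 2.
Proof.
rewrite /= !inE andbT negb_and !negbK => /orP[/orP[]|] /eqP->.
- by rewrite perimeterxx eqxx.
- by rewrite -perimeter_rot perimeterxx eq_sym andbb.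
- by rewrite perimeter_rot perimeterxx eqxx andbT eq_sym.
Qed.

(** The triangle inequality gives the lower bound. It also gives the upper one, since a triangle and
    its reverse have perimeters of sum 6. *)
Lemma perimeter_bounds x y z : uniq [:: x; y; z] ->
  (2 <= perimeter x y z <= 4)%N.
Proof.
rewrite /= !inE negb_or andbT => /andP[/andP[xy xz] yz].
have := distC x y; have := distC y z; have := distC x z.
rewrite (negbTE xy) (negbTE xz) (negbTE yz) /perimeter.
have := dist_triangle x y z; have := dist_triangle z y x.
lia.
Qed.

Lemma O23_perimeter x y z :
  (O2 x y z = uniq [:: x; y; z] && (perimeter x y z == 2%N)) *
  (O3 x y z = uniq [:: x; y; z] && (perimeter x y z == 4%N)).
Proof.
rewrite /O2 /O3; case xyz: (uniq _) => //=.
have := @le_trans _ _ y x z; have := @le_trans _ _ x z y.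
have := @le_trans _ _ z y x; have := @le_trans _ _ z x y.
have := @le_trans _ _ x y z; have := @le_trans _ _ y z x.
move: xyz; rewrite /= !inE negb_or andbT => /andP[/andP[xy xz] yz].
rewrite /perimeter /dist !lt_neqAle /Order.comparable.
rewrite (eq_sym y x) (eq_sym z x) (eq_sym z y) xy xz yz /=.
move: xy xz yz; rewrite !eq_le.
case: (x <= y) (y <= x) (y <= z) (z <= y) (x <= z) (z <= x)
  => [] [] [] [] [] [] //= _ _ _ h1 h2 h3 h4 h5 h6;
  first [ by have := h1 isT isT | by have := h2 isT isT | by have := h3 isT isT
        | by have := h4 isT isT | by have := h5 isT isT | by have := h6 isT isT ].
Qed.

Lemma O_structure_perimeter i x y z :
  O_structure P i x y z =
  uniq [:: x; y; z] && (perimeter x y z == nth 0%N [:: 3; 2; 4] i).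
Proof.
have O1E : O1 x y z = uniq [:: x; y; z] && (perimeter x y z == 3).
  rewrite /O1 !O23_perimeter; case xyz: (uniq _) => //=.
  have := perimeter_bounds xyz; lia.
rewrite /O_structure (tnth_nth (@O1 _ P)).
by case: i => -[|[|[|//]]] _ /=; rewrite ?O1E ?O23_perimeter.
Qed.

(** The distance from [b] back to the new point has to be [2 - D b]. The last two hypotheses are
    triangle inequalities involving the new point, rearranged to avoid subtraction. *)
Lemma realize_distances (Q : {fset P}) (D : P -> nat) :
  extension_property P ->
  {in Q, forall b, (D b <= 2)%N} ->
  {in Q &, forall b c, (D c <= D b + dist b c)%N} ->
  {in Q &, forall b c, (dist b c + D b <= 2 + D c)%N} ->
  exists2 q : P, q \notin Q &
    {in Q, forall b, dist q b = D b}.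
Proof.
move=> ext D2 Dtri1 Dtri2.
pose D' (u v : option Q) : nat :=
  match u, v with
  | None, None => 0
  | None, Some b => D (fsval b)
  | Some b, None => (2 - D (fsval b))%N
  | Some b, Some c => dist (fsval b) (fsval c)
  end.
have [|q qQ qE] := ext Q (fun u v => D' u v == 0%N).
  split.
  - by case=> [b|] //=; rewrite distxx.
  - move=> [b|] [c|] //=.
    + by rewrite !dist_eq0 -eq_le => /eqP/val_inj->.
    + by case/andP=> /eqP h1 /eqP h2; lia.
    + by case/andP=> /eqP h1 /eqP h2; lia.
  - move=> [b|] [a|] [c|] //= /eqP h1 /eqP h2; apply/eqP.
    + by have := dist_triangle (fsval a) (fsval b) (fsval c); lia.
    + have := Dtri2 _ _ (fsvalP a) (fsvalP b).
      have := Dtri1 _ _ (fsvalP a) (fsvalP b); have := D2 _ (fsvalP a); lia.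
    + have := Dtri1 _ _ (fsvalP b) (fsvalP c); lia.
    + have := Dtri2 _ _ (fsvalP a) (fsvalP c); lia.
  - by move=> b c; rewrite /= dist_eq0.
exists q => // b bQ.
(* The extension only tells which distances vanish; as the two directions add up to 2, this
   determines them. *)
have := qE None (Some [` bQ]%fset); have := qE (Some [` bQ]%fset) None.
rewrite /= -!dist_eq0 => h1 h2.
have := distC q b; case: eqP => [qb|_]; first by rewrite qb bQ in qQ.
have := D2 _ bQ; lia.
Qed.

(** * Finite perimeter-preserving maps and their extension *)

Definition perimeter_preserving (L : seq (P * P)) : bool :=
  all (fun u => all (fun v => all (fun w =>
    perimeter u.1 v.1 w.1 == perimeter u.2 v.2 w.2) L) L) L.

Lemma perimeter_preservingP L :
  reflect (forall u v w : P * P, u \in L -> v \in L -> w \in L ->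
             perimeter u.1 v.1 w.1 = perimeter u.2 v.2 w.2)
          (perimeter_preserving L).
Proof.
apply: (iffP allP) => [h u v w uL vL wL|h u uL].
  by have /allP/(_ v vL)/allP/(_ w wL)/eqP := h u uL.
by apply/allP=> v vL; apply/allP=> w wL; apply/eqP; apply: h.
Qed.

(** Degenerate triples detect equality: the perimeter of [u, u, v] is 0 or 2. *)
Lemma perimeter_preserving_inj L (u v : P * P) : perimeter_preserving L ->
  u \in L -> v \in L -> (u.1 == v.1) = (u.2 == v.2).
Proof.
move=> /perimeter_preservingP gL uL vL.
have := gL u u v uL uL vL; rewrite !perimeterxx.
by do 2 case: ifP.
Qed.

Lemma perimeter_preserving_swap L :
  perimeter_preserving L ->
  perimeter_preserving [seq (u.2, u.1) | u <- L].
Proof.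
move=> /perimeter_preservingP gL; apply/perimeter_preservingP.
by move=> _ _ _ /mapP[u uL ->] /mapP[v vL ->] /mapP[w wL ->] /=; rewrite gL.
Qed.

(** Rotation brings new pairs to the front of a triple; if there are at least two of them, only
    equality matters. *)
Lemma perimeter_preserving_cons p q L :
  perimeter_preserving L ->
  (forall u : P * P, u \in L -> (p == u.1) = (q == u.2)) ->
  (forall u v : P * P, u \in L -> v \in L ->
    perimeter p u.1 v.1 = perimeter q u.2 v.2) ->
  perimeter_preserving ((p, q) :: L).
Proof.
move=> /perimeter_preservingP gL eqpq gpq; apply/perimeter_preservingP.
have pp u : u \in L -> perimeter p p u.1 = perimeter q q u.2.
  by move=> uL; rewrite !perimeterxx eqpq.
move=> u v w; rewrite !inE.
move=> /predU1P[->|uL] /predU1P[->|vL] /predU1P[->|wL] /=.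
- by rewrite !perimeterxx !eqxx.
- exact: pp.
- by rewrite -!(perimeter_rot _ _ v.1) -!(perimeter_rot _ _ v.2); apply: pp.
- exact: gpq.
- by rewrite perimeter_rot (perimeter_rot u.2); apply: pp.
- by rewrite perimeter_rot (perimeter_rot u.2); apply: gpq.
- by rewrite -perimeter_rot -(perimeter_rot q); apply: gpq.
- exact: gL.
Qed.

(* The change of [dist] along a perimeter-preserving map is a coboundary,
   with both sides rearranged to avoid subtraction. *)
Lemma perimeter_preserving_dist L (u v w : P * P) : perimeter_preserving L ->
  u \in L -> v \in L -> w \in L ->
  (dist u.2 v.2 + dist v.2 w.2 + dist u.1 w.1 =
   dist u.1 v.1 + dist v.1 w.1 + dist u.2 w.2)%N.
Proof.
move=> gL uL vL wL.
have := perimeter_preservingP _ gL u v w uL vL wL; rewrite /perimeter.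
have := distC u.1 w.1; have := distC u.2 w.2.
by rewrite (perimeter_preserving_inj gL uL wL); case: ifP => _; lia.
Qed.

Lemma perimeter_preserving_forth L p : extension_property P ->
  perimeter_preserving L -> exists q, perimeter_preserving ((p, q) :: L).
Proof.
move=> ext gL; have [/mapP[u uL ->]|pL] := boolP (p \in map fst L).
  exists u.2; apply: perimeter_preserving_cons => // [v vL|v w vL wL].
    exact: perimeter_preserving_inj gL uL vL.
  exact: (perimeter_preservingP _ gL).
case: (L =P [::]) => [->|/eqP].
  by exists p; apply: perimeter_preserving_cons.
rewrite -size_eq0 -lt0n => L0.
have [a aL] : exists a : P * P, a \in L by exists (nth (p, p) L 0); rewrite mem_nth.
(* [a0] attains the strongest lower bound on the integer attached to [p]. *)
have [a0 a0L a0min] : exists2 a0 : P * P, a0 \in L & forall u : P * P,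
    u \in L -> (dist a0.2 u.2 + dist a0.1 p <= dist a0.1 u.1 + dist u.1 p)%N.
  (* With [k u = dist a.2 u.2 - dist a.1 u.1], the integer [k p] must satisfy [k u - dist u.1 p <= k
     p <= k u + dist p u.1]. Here [K u] is 2 minus the lower bound, the shift by 2 keeping it
     natural, so minimizing [K] maximizes that bound. *)
  pose K (u : P * P) := (dist u.1 p + dist a.1 u.1 + (2 - dist a.2 u.2))%N.
  have exK : exists n, has (fun u => K u <= n)%N L.
    by exists (K a); apply/hasP; exists a.
  have [m /hasP[a0 a0L Ka0] mmin] := ex_minnP exK.
  exists a0 => // u uL.
  have : (m <= K u)%N by apply: mmin; apply/hasP; exists u.
  have := perimeter_preserving_dist gL aL a0L uL.
  have := dist_le2 a.2 a0.2; have := dist_le2 a.2 u.2.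
  move: Ka0; rewrite /K; lia.
(* [pre] inverts [L] on its second components and returns [p] elsewhere. *)
pose pre b := nth p (map fst L) (index b (map snd L)).
have preL b : b \in map snd L -> (pre b, b) \in L.
  move=> bL; have iL : (index b (map snd L) < size L)%N.
    by rewrite -(size_map snd) index_mem.
  have -> : (pre b, b) = nth (p, b) L (index b (map snd L)).
    rewrite [RHS]surjective_pairing -(nth_map _ p fst) // -(nth_map _ b snd) //.
    by rewrite nth_index.
  exact: mem_nth.
have preE (u : P * P) : u \in L -> pre u.2 = u.1.
  move=> uL; have vL : (pre u.2, u.2) \in L by apply: preL; apply: map_f.
  by apply/eqP; rewrite (perimeter_preserving_inj gL vL uL).
(* This is [dist p u.1 + k u - k p] at [b = u.2], with [k p] the lower bound given by [a0]; in
   particular [D a0.2 = 2]. By the triangle inequality the subtraction is not truncated on [L]. *)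
pose D b :=
  (dist a0.2 b + (dist a0.1 p + dist p (pre b)) - dist a0.1 (pre b))%N.
have DE (u : P * P) : u \in L ->
    (D u.2 + dist a0.1 u.1 = dist a0.2 u.2 + (dist a0.1 p + dist p u.1))%N.
  move=> uL; rewrite /D preE //.
  have := dist_triangle a0.1 p u.1; lia.
have pu (u : P * P) : u \in L -> (dist p u.1 + dist u.1 p = 2)%N.
  move=> uL; rewrite distC; case: eqP => // pu.
  by case/negP: pL; rewrite pu map_f.
pose Q := [fset b in map snd L]%fset.
have QP b : b \in Q -> exists2 u : P * P, u \in L & b = u.2.
  by rewrite inE => /mapP.
have D2 (u : P * P) : u \in L -> (D u.2 <= 2)%N.
  by move=> uL; have := a0min u uL; have := DE u uL; have := pu u uL; lia.
have [||_ _ /QP[u uL ->] /QP[v vL ->]|q qQ qD] := @realize_distances Q D ext.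
- by move=> _ /QP[u uL ->]; apply: D2.
- move=> _ _ /QP[u uL ->] /QP[v vL ->].
  have := DE u uL; have := DE v vL.
  have := perimeter_preserving_dist gL a0L uL vL.
  have := dist_triangle p u.1 v.1; lia.
- have := DE u uL; have := DE v vL.
  have := perimeter_preserving_dist gL a0L uL vL.
  have := pu u uL; have := dist_triangle u.1 p v.1; lia.
have uQ (u : P * P) : u \in L -> u.2 \in Q by move=> uL; rewrite inE map_f.
have qu (u : P * P) : u \in L -> (q == u.2) = false.
  by move=> uL; apply/eqP=> qu; rewrite qu uQ in qQ.
exists q; apply: perimeter_preserving_cons => // [u uL|u v uL vL].
  by rewrite qu //; apply/eqP=> pu1; case/negP: pL; rewrite pu1 map_f.
have := distC q v.2; rewrite qu // /perimeter !qD ?uQ // => qv.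
have := DE u uL; have := DE v vL.
have := perimeter_preserving_dist gL a0L uL vL.
have := pu v vL; lia.
Qed.

(** This is the forth step for the inverse map. *)
Lemma perimeter_preserving_back L q : extension_property P ->
  perimeter_preserving L -> exists p, perimeter_preserving ((p, q) :: L).
Proof.
move=> ext /perimeter_preserving_swap/(perimeter_preserving_forth q ext).
move=> [p /perimeter_preserving_swap]; rewrite /= -map_comp.
by rewrite (eq_map (g := id)) ?map_id => [|[]//]; exists p.
Qed.

End Distance.

Theorem theorem4p4 (d : Order.disp_t) (P : porderType d)
    (hP : random_poset P) : homogeneous (O_structure P).
Proof.
case: hP => -[e [e' eK e'K]] ext A B f [/bij_inj f_inj fO].
pose L0 := [seq (val x, val (f x)) | x <- enum {: A}].
have gL0 : perimeter_preserving L0.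
  apply/perimeter_preservingP => _ _ _ /mapP[x _ ->] /mapP[y _ ->] /mapP[z _ ->].
  have fE (u v : A) : (val (f u) == val (f v)) = (val u == val v).
    by rewrite !val_eqE (inj_eq f_inj).
  have uE : uniq [:: val (f x); val (f y); val (f z)] =
            uniq [:: val x; val y; val z] by rewrite /= !inE !fE.
  have [xyz|xyz] := boolP (uniq [:: val x; val y; val z]); last first.
    by rewrite /= !perimeter_degenerate ?uE // !fE.
  have := perimeter_bounds xyz; move: (xyz); rewrite -uE => /perimeter_bounds.
  (* Both perimeters lie between 2 and 4, and the three relations tell these values apart. *)
  have := fO (@Ordinal 3 0 isT) x y z; have := fO (@Ordinal 3 1 isT) x y z.
  have := fO (@Ordinal 3 2 isT) x y z.
  rewrite /induced !O_structure_perimeter uE xyz /=; lia.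
have [g g_bij gP] := back_and_forth e'K (@perimeter_preserving_inj _ P)
  (fun L p => @perimeter_preserving_forth _ P L p ext)
  (fun L p => @perimeter_preserving_back _ P L p ext) gL0.
have g_inj := bij_inj g_bij.
exists g; split=> [|x].
  split=> // i x y z; have [L gL [_ sL]] := gP [:: x; y; z].
  have xL : (x, g x) \in L by rewrite sL ?inE ?eqxx.
  have yL : (y, g y) \in L by rewrite sL ?inE ?eqxx ?orbT.
  have zL : (z, g z) \in L by rewrite sL ?inE ?eqxx ?orbT.
  rewrite !O_structure_perimeter -(map_inj_uniq g_inj) /=.
  by rewrite (perimeter_preservingP _ gL _ _ _ xL yL zL).
(* One good list contains both pairs starting at [val x], so injectivity identifies their second
   components. *)
have [L gL [sub0 sL]] := gP [:: val x].
have xL : (val x, val (f x)) \in L by rewrite sub0 // map_f // mem_enum.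
have gxL : (val x, g (val x)) \in L by rewrite sL ?inE.
by apply/eqP; have := perimeter_preserving_inj gL gxL xL; rewrite eqxx /= => <-.
Qed.
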